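(* Let $A\in\mathbb{R}^{n\times n}$ be diagonalizable (over $\mathbb{C}$) with eigenvalues $\lambda_1,\dots,\lambda_n$ counted with multiplicity, let the system $\dot x=Ax$ be strongly eventually positive, and let $\lambda_1$ be a simple (real) eigenvalue of $A$ with $\lambda_1>\Re(\lambda_j)$ for all $j\ge 2$. Let $v^1,w^1\in\mathbb{R}^n$ be right and left eigenvectors of $A$ corresponding to $\lambda_1$, chosen so that $v^1\gg 0$ and $w^1\gg 0$, and let $w^1,w^2,\dots,w^n$ be linearly independent left eigenvectors corresponding to $\lambda_1,\dots,\lambda_n$. For positive scalars $\alpha_2,\dots,\alpha_n$ let $$\mathcal{K}_\alpha=\left\{y\in\mathbb{R}^n \;\middle|\; \left(\sum_{i=2}^n\alpha_i\,|(w^i)^Ty|^2\right)^{1/2}\le (w^1)^Ty\right\}.$$ Then: (i) the system $\dot x=Ax$ is asymptotically stable if and only if there exists a vector $\xi\gg 0$ in $\mathbb{R}^n$ such that $\xi^TA\ll 0$; (ii) for any $\xi\gg 0$ such that $\xi^TA\ll 0$ and any $\alpha_i>0$ such that $\mathcal{K}_\alpha\subseteq\mathbb{R}^n_{\ge 0}$, the function $V_s(x)=\xi^Tx$ is a Lyapunov function on $\mathcal{K}_\alpha$. Moreover, the function $V_s(x)=x^Tw^1$ is a Lyapunov function on $\mathcal{K}_\alpha$ for any $\alpha_i>0$, including values for which $\mathbb{R}^n_{\ge 0}\subseteq\mathcal{K}_\alpha$; (iii) there exist $\alpha_i>0$ such that $\mathcal{K}_\alpha\subseteq\mathbb{R}^n_{\ge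 0}$ and $V_m(x)=\max\{x_1/v^1_1,\dots,x_n/v^1_n\}$ is a Lyapunov function on $\mathcal{K}_\alpha$.
   Context: For vectors, $x\gg 0$ (resp. $x\ll 0$) means all entries are strictly positive (resp. strictly negative). $\mathbb{R}^n_{\ge 0}$ is the nonnegative orthant and $\mathbb{R}^n_{>0}$ its interior. The system $\dot x=Ax$ is strongly eventually positive if there exists $\tau_0\ge 0$ such that $e^{At}x\in\mathbb{R}^n_{>0}$ for every nonzero $x\in\mathbb{R}^n_{\ge 0}$ and all $t\ge\tau_0$. (For such systems the eigenvectors $v^1,w^1$ can be chosen entrywise positive.) A left eigenvector for $\lambda_i$ is a nonzero $w^i\in\mathbb{C}^n$ with $(w^i)^TA=\lambda_i(w^i)^T$. A Lyapunov function for $\dot x=Ax$ on a cone $\mathcal{S}$ is a continuous function $V$ with $V(0)=0$, $V(x)>0$ for all $x\in\mathcal{S}\setminus\{0\}$, and $\dot V(x)<0$ for all $x\in\mathcal{S}\setminus\{0\}$, where $\dot V(x)$ is the derivative of $V$ along the solution of $\dot x=Ax$ through $x$ (upper right Dini derivative, where $V$ is not differentiable).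
   Formalization: The claim in (ii) about x^T w^1 and all of (iii) are stated under the added assumption that the system is asymptotically stable; without it both fail, e.g. for A=[[1,1],[1,1]], since along v^1 both functions grow at rate λ_1=2. *)

(* Defs.v *)
From HB Require Import structures.
From mathcomp Require Import all_boot all_order all_algebra.
From mathcomp Require Import all_classical all_reals all_analysis.
From mathcomp Require Import complex.

Set Implicit Arguments.
Unset Strict Implicit.
Unset Printing Implicit Defensive.

Import Order.TTheory GRing.Theory Num.Theory.
Import numFieldNormedType.Exports.

Local Open Scope classical_set_scope.
Local Open Scope ring_scope.

(* Matrices carry the sup norm of their entries, so this is the entrywise limit
   of the exponential series. *)
Definition expmx (R : realType) (n : nat) (A : 'M[R]_n.+1) : 'M[R]_n.+1 :=
  limn (series (fun k : nat => (k`!%:R)^-1 *: A ^+ k)).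

Definition flow (R : realType) (n : nat) (A : 'M[R]_n.+1) (t : R)
    (x : 'cV[R]_n.+1) : 'cV[R]_n.+1 :=
  expmx (t *: A) *m x.

Definition nonneg_orthant (R : realType) (n : nat) : set 'cV[R]_n.+1 :=
  [set x | forall i, 0 <= x i ord0].

Definition pos_orthant (R : realType) (n : nat) : set 'cV[R]_n.+1 :=
  [set x | forall i, 0 < x i ord0].

Arguments nonneg_orthant : clear implicits.
Arguments pos_orthant : clear implicits.

Definition strongly_eventually_positive (R : realType) (n : nat)
    (A : 'M[R]_n.+1) : Prop :=
  exists2 tau0 : R, 0 <= tau0 &
    forall x : 'cV[R]_n.+1, nonneg_orthant R n x -> x != 0 ->
    forall t : R, tau0 <= t -> pos_orthant R n (flow A t x).

Definition lyapunov_stable (R : realType) (n : nat) (A : 'M[R]_n.+1) : Prop :=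
  forall eps : R, 0 < eps -> exists2 delta : R, 0 < delta &
    forall x : 'cV[R]_n.+1, `|x| < delta ->
    forall t : R, 0 <= t -> `|flow A t x| < eps.

Definition locally_attractive (R : realType) (n : nat)
    (A : 'M[R]_n.+1) : Prop :=
  exists2 r : R, 0 < r &
    forall x : 'cV[R]_n.+1, `|x| < r ->
    flow A t x @[t --> +oo] --> (0 : 'cV[R]_n.+1).

Definition asymptotically_stable (R : realType) (n : nat)
    (A : 'M[R]_n.+1) : Prop :=
  lyapunov_stable A /\ locally_attractive A.

(* Upper right Dini derivative of V along the solution through x; it is the
   ordinary derivative wherever V is differentiable. *)
Definition orbital_derivative (R : realType) (n : nat) (A : 'M[R]_n.+1)
    (V : 'cV[R]_n.+1 -> R) (x : 'cV[R]_n.+1) : \bar R :=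
  limf_esup (fun h : R => ((V (flow A h x) - V x) / h)%:E) 0^'+.

Definition is_lyapunov_on (R : realType) (n : nat) (A : 'M[R]_n.+1)
    (S : set 'cV[R]_n.+1) (V : 'cV[R]_n.+1 -> R) : Prop :=
  [/\ continuous V,
      V 0 = 0,
      (forall x, S x -> x != 0 -> 0 < V x) &
      (forall x, S x -> x != 0 -> (orbital_derivative A V x < 0)%E)].

Definition cplx_mx (R : realType) (m n : nat) (M : 'M[R]_(m, n)) :
    'M[R[i]]_(m, n) :=
  map_mx (real_complex R) M.

(* alpha i is the weight of the left eigenvector w (lift ord0 i); the dominant
   eigenvector w1 = w ord0 carries no weight. *)
Definition cone (R : realType) (n : nat) (w1 : 'cV[R]_n.+1)
    (w : 'I_n.+1 -> 'cV[R[i]]_n.+1) (alpha : 'I_n -> R) : set 'cV[R]_n.+1 :=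
  [set y | Num.sqrt (\sum_(i < n) alpha i *
             ComplexField.Normc.normc
               (((w (lift ord0 i))^T *m cplx_mx y) ord0 ord0) ^+ 2)
           <= (w1^T *m y) ord0 ord0].

(* The entry at ord0 is only the seed of the iterated maximum: it is one of the
   competing values, so the maximum is exactly over all coordinates. *)
Definition max_ratio (R : realType) (n : nat) (v x : 'cV[R]_n.+1) : R :=
  \big[Num.max/(x ord0 ord0 / v ord0 ord0)]_(i < n.+1) (x i ord0 / v i ord0).

(* Main.v *)
Require Import Defs.
From HB Require Import structures.
From mathcomp Require Import all_boot all_order all_algebra.
From mathcomp Require Import all_classical all_reals all_analysis.
From mathcomp Require Import complex.
From mathcomp Require Import ring lra.

Set Implicit Arguments.
Unset Strict Implicit.
Unset Printing Implicit Defensive.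

Import Order.TTheory GRing.Theory Num.Theory.
Import numFieldNormedType.Exports.
Import ComplexField.Normc.

Local Open Scope classical_set_scope.
Local Open Scope ring_scope.

(** Everything reduces to the modal coordinates z_i = (w i)^T x. Along a
trajectory each of them evolves on its own, with
|z_i(t)| = e^(Re lambda_i t) |z_i(0)| ([normc_lcoord_flow]), and since the w i
form a basis, the entries of x are bounded by the moduli |z_i|
([entry_le_lcoord]).

Stability. If lambda1 < 0 then all the moduli decay and x(t) tends to 0
([negative_spectrum_stable]); conversely, the trajectory of a small multiple of
v1 can only converge to 0 if its coordinate along w1, which scales as
e^(lambda1 t), does ([stable_real_eigenvalue_lt0]). So asymptotic stability
means lambda1 < 0. A vector xi with xi >> 0 and xi^T A << 0 exists exactly then:
w1 is one when lambda1 < 0, and pairing xi^T A with v1 >> 0 gives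
lambda1 xi^T v1 < 0.

Linear functions. The derivative of xi^T x along the flow is xi^T A x, which is
negative on the nonzero vectors of the orthant when xi^T A << 0. For w1^T x it is
lambda1 w1^T x, and w1^T x > 0 at nonzero points of any cone K_alpha, because
w1^T x = 0 would force every z_i to vanish ([cone_z1_gt0]). Small weights make
K_alpha contain the orthant ([nonneg_orthant_sub_cone]).

The maximum of the ratios x_k / v1_k. For large weights all the coordinates
other than w1^T x are small compared with it, so after scaling x is close to v1
and A x is close to lambda1 v1 ([narrow_cone_near_v1]). When lambda1 < 0, a
narrow enough cone therefore has x >> 0 and A x << 0 at each of its nonzero
points ([narrow_cone]). All ratios then decrease at once, hence so does their
maximum ([max_ratio_orbital_lt0]). *)

(** * Entrywise convergence of matrices *)

Lemma ler_mx_entry (R : realDomainType) m n (M : 'M[R]_(m, n)) i j :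
  `|M i j| <= mx_norm M.
Proof. by rewrite mx_normrE; exact: (le_bigmax _ _ (i, j)). Qed.

Lemma ler_mx_normP (R : realDomainType) m n (M : 'M[R]_(m, n)) (e : R) :
  0 <= e -> (forall i j, `|M i j| <= e) -> mx_norm M <= e.
Proof. by move=> e0 Me; rewrite mx_normrE; apply: bigmax_le => // -[]. Qed.

Lemma mx_norm_ge0 (R : realDomainType) m n (M : 'M[R]_(m, n)) : 0 <= mx_norm M.
Proof. exact: (normr_ge0 M). Qed.

Lemma mx_norm_mul (R : realDomainType) m n p (M : 'M[R]_(m, n))
  (N : 'M[R]_(n, p)) : mx_norm (M *m N) <= n%:R * mx_norm M * mx_norm N.
Proof.
apply: ler_mx_normP => [|i j].
  by rewrite !mulr_ge0 ?mx_norm_ge0.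
rewrite mxE (le_trans (ler_norm_sum _ _ _)) //.
have -> : n%:R * mx_norm M * mx_norm N = \sum_(k < n) mx_norm M * mx_norm N.
  by rewrite sumr_const card_ord -mulrA mulr_natl.
apply: ler_sum => k _; rewrite normrM.
by apply: ler_pM => //; exact: ler_mx_entry.
Qed.

Lemma cvg_mxP (R : realFieldType) (T : Type) (F : set_system T) (FF : Filter F)
  m n (f : T -> 'M[R]_(m, n)) (M : 'M[R]_(m, n)) :
  (forall i j, f x i j @[x --> F] --> M i j) <-> f x @[x --> F] --> M.
Proof.
split => [fM|fM i j]; last first.
  exact: (cvg_comp _ _ fM (@coord_continuous R m n i j M)).
apply/cvgrPdist_le => e e0; near=> x.
change (mx_norm (M - f x) <= e); apply: ler_mx_normP; first exact: ltW.
move=> i j; rewrite !mxE; move: i j; near: x.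
apply: filter_forall => i; apply: filter_forall => j.
exact: (cvgrPdist_le _ _).1.
Unshelve. all: by end_near. Qed.

(** Scalar functionals M |-> a M b are how the matrix exponential is studied:
they turn its limit into limits of real power series. *)
Lemma cvg_bilin (R : realFieldType) (T : Type) (F : set_system T)
  {FF : Filter F} m n (f : T -> 'M[R]_(m, n)) (M : 'M[R]_(m, n))
  (a : 'rV[R]_m) (b : 'cV[R]_n) : f x @[x --> F] --> M ->
  (a *m f x *m b) ord0 ord0 @[x --> F] --> (a *m M *m b) ord0 ord0.
Proof.
move=> /cvg_mxP fM; under eq_fun do rewrite mxE; rewrite mxE.
apply: (cvg_big (op := +%R)) => [|j _]; first exact: add_continuous.
apply: cvgMr_tmp.
under eq_fun do rewrite mxE; rewrite mxE.
apply: (cvg_big (op := +%R)) => [|i _]; first exact: add_continuous.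
exact: cvgMl_tmp.
Qed.

(** * The matrix exponential and its trajectories *)

Section flow.
Variables (R : realType) (n : nat) (A : 'M[R]_n.+1).
Implicit Types (a : 'rV[R]_n.+1) (x : 'cV[R]_n.+1) (t : R).

(** The Taylor coefficients at 0 of t |-> a e^(tA) x. *)
Definition flow_coeff a x (k : nat) : R := (k`!%:R)^-1 * (a *m A ^+ k *m x) ord0 ord0.

(** Formal differentiation of the series only replaces a by a A, so the
family of these series is closed under differentiation. *)
Lemma pseries_diffs_flow_coeff a x :
  pseries_diffs (flow_coeff a x) = flow_coeff (a *m A) x.
Proof.
apply/funext => k; rewrite /pseries_diffs /flow_coeff mulrA factS natrM invfM.
by rewrite mulrA divff ?pnatr_eq0 // mul1r exprS -mulmxE mulmxA.
Qed.

(** This growth is at most geometric, so the series is dominated by a real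
exponential series. *)
Lemma norm_bilin_exp a x k : `|(a *m A ^+ k *m x) ord0 ord0| <=
  n.+1%:R * mx_norm a * mx_norm x * (n.+1%:R * mx_norm A) ^+ k.
Proof.
apply: le_trans (ler_mx_entry _ _ _) _; rewrite -mulmxA.
apply: le_trans (mx_norm_mul _ _) _; rewrite -[leRHS]mulrA.
rewrite ler_wpM2l ?mulr_ge0 ?mx_norm_ge0 //; elim: k => [|k IH].
  by rewrite !expr0 mul1mx mulr1.
rewrite exprS -mulmxE -mulmxA (le_trans (mx_norm_mul _ _)) //.
by rewrite exprS mulrCA ler_wpM2l ?mulr_ge0 ?mx_norm_ge0.
Qed.

Lemma is_cvg_flow_coeff a x t : cvgn (pseries (flow_coeff a x) t).
Proof.
apply: normed_cvg.
set K := n.+1%:R * mx_norm a * mx_norm x; set B := n.+1%:R * mx_norm A.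
have K0 : 0 <= K by rewrite !mulr_ge0 ?mx_norm_ge0.
have B0 : 0 <= B by rewrite mulr_ge0 ?mx_norm_ge0.
apply: (@series_le_cvg _ _ (K *: exp_coeff (B * `|t|))).
- by move=> k; exact: normr_ge0.
- by move=> k; rewrite mulr_ge0 // exp_coeff_ge0 // mulr_ge0.
- move=> k; rewrite /flow_coeff /= /exp_coeff /= !normrM normfV normr_nat normrX.
  rewrite -mulrA mulrC [leRHS]mulrA ler_wpM2r ?invr_ge0 //.
  by rewrite exprMn mulrA ler_wpM2r ?exprn_ge0 // norm_bilin_exp.
- by apply: is_cvg_seriesZ; exact: is_cvg_series_exp_coeff.
Qed.

Lemma bilin_partial_exp a x t N :
  (a *m (series (fun k : nat => (k`!%:R)^-1 *: (t *: A) ^+ k) N) *m x) ord0 ord0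
  = pseries (flow_coeff a x) t N.
Proof.
rewrite /pseries /series /= mulmx_sumr mulmx_suml summxE.
apply: eq_bigr => k _; rewrite exprZn scalerA -scalemxAr -scalemxAl mxE.
by rewrite /flow_coeff mulrAC.
Qed.

(** The entries of the exponential series are themselves series of this form,
for a and x in the canonical bases; hence the matrix series converges, and its
limit commutes with any functional. *)
Lemma flow_pseries a x t :
  (a *m flow A t x) ord0 ord0 = limn (pseries (flow_coeff a x) t).
Proof.
pose S := series (fun k : nat => (k`!%:R)^-1 *: (t *: A) ^+ k).
have cS : S @ \oo --> expmx (t *: A).
  suff : cvgn S by [].
  apply/cvg_ex; exists (\matrix_(i, j)
    limn (pseries (flow_coeff (delta_mx ord0 i) (delta_mx j ord0)) t)).
  apply/cvg_mxP => i j; rewrite mxE.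
  have -> : (fun N => S N i j) =
      pseries (flow_coeff (delta_mx ord0 i) (delta_mx j ord0)) t.
    by apply/funext => N; rewrite -bilin_partial_exp -rowE -colE !mxE.
  exact: is_cvg_flow_coeff.
rewrite mulmxA -(cvg_lim _ (cvg_bilin (a := a) (b := x) cS)) //.
by congr (limn _); apply/funext => N; rewrite bilin_partial_exp.
Qed.

(** The differential equation x' = A x tested against a row vector, obtained by
termwise differentiation: the series converges on the whole real line. *)
Lemma is_derive_flow a x t :
  is_derive t 1 (fun s => (a *m flow A s x) ord0 ord0)
    ((a *m A *m flow A t x) ord0 ord0).
Proof.
have -> : (fun s => (a *m flow A s x) ord0 ord0) =
    fun s => limn (pseries (flow_coeff a x) s).
  by apply/funext => s; rewrite flow_pseries.
rewrite flow_pseries -pseries_diffs_flow_coeff.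
apply: (@pseries_snd_diffs _ _ (`|t| + 1)); rewrite ?pseries_diffs_flow_coeff;
  try exact: is_cvg_flow_coeff.
by rewrite [ltRHS]ger0_norm ?addr_ge0 // ltrDl.
Qed.

Lemma flow0 x : flow A 0 x = x.
Proof.
apply/colP => i.
have E (y : 'cV[R]_n.+1) : y i ord0 = (delta_mx ord0 i *m y : 'M[R]_1) ord0 ord0.
  by rewrite -rowE mxE.
rewrite [LHS]E [RHS]E flow_pseries; apply/cvg_lim => //.
(* Past the empty partial sum, the series at 0 is constant. *)
rewrite -(cvg_shiftn 1) /=.
have -> : (fun k => pseries (flow_coeff (delta_mx ord0 i) x) 0 (k + 1)%N) =
  cst ((delta_mx ord0 i *m x : 'M[R]_1) ord0 ord0).
  apply/funext => k; rewrite /pseries /series /= addn1 big_nat_recl //=.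
  rewrite big1 ?addr0 => [|j _]; last by rewrite expr0n mulr0.
  by rewrite /flow_coeff expr0 mulmx1 fact0 invr1 mul1r expr0 mulr1.
exact: cvg_cst.
Qed.

(** One-sided difference quotients at 0, in the shape used by the Dini
derivative along the flow. *)
Lemma flow_quotient a x :
  (((a *m flow A h x) ord0 ord0 - (a *m x) ord0 ord0) / h) @[h --> 0^'+] -->
  (a *m A *m x) ord0 ord0.
Proof.
have [d] := is_derive_flow a x 0; rewrite flow0 => De.
have /cvgrPdist_le cv : (fun h : R => h^-1 *:
    (((fun s => (a *m flow A s x) ord0 ord0) \o shift 0) (h *: 1) -
     (a *m flow A 0 x) ord0 ord0)) @ 0^' --> (a *m A *m x) ord0 ord0.
  by rewrite -De; exact: d.
apply/cvgrPdist_le => e e0; have := cv _ e0.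
rewrite !near_withinE; apply: filterS => h H h0.
have /= := H (lt0r_neq0 h0).
by rewrite flow0 addr0 /GRing.scale /= mulr1 mulrC.
Qed.
End flow.
Arguments flow_quotient {R n} A a x.

(** * Coordinates along complex left eigenvectors *)

Section left_coordinate.
Variables (R : realType) (n : nat).
Implicit Types (w : 'cV[R[i]]_n.+1) (x : 'cV[R]_n.+1) (z : R[i]).

Lemma normc_sum (I : Type) (r : seq I) (F : I -> R[i]) :
  normc (\sum_(i <- r) F i) <= \sum_(i <- r) normc (F i).
Proof.
elim/big_ind2 : _ => [|a b c d ab cd|//]; first by rewrite normc0.
exact: le_trans (le_normcD _ _) (lerD ab cd).
Qed.

Lemma normc_ge0 z : 0 <= normc z.
Proof. by case: z => a b; exact: sqrtr_ge0. Qed.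

Lemma normc_real (r : R) : normc (real_complex R r) = `|r|.
Proof. by rewrite /= expr0n addr0 sqrtr_sqr. Qed.

Lemma sqr_normc_ReIm (a b : R) : normc (a +i* b)%C ^+ 2 = a ^+ 2 + b ^+ 2.
Proof. by rewrite sqr_sqrtr // addr_ge0 ?sqr_ge0. Qed.

Definition lcoord w x : R[i] := (w^T *m cplx_mx x) ord0 ord0.

Definition Re_row w : 'rV[R]_n.+1 := \row_i complex.Re (w i ord0).
Definition Im_row w : 'rV[R]_n.+1 := \row_i complex.Im (w i ord0).

Lemma Re_sum (I : Type) (r : seq I) (F : I -> R[i]) :
  complex.Re (\sum_(i <- r) F i) = \sum_(i <- r) complex.Re (F i).
Proof. exact: raddf_sum. Qed.

Lemma Im_sum (I : Type) (r : seq I) (F : I -> R[i]) :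
  complex.Im (\sum_(i <- r) F i) = \sum_(i <- r) complex.Im (F i).
Proof. exact: raddf_sum. Qed.

Lemma Re_mulr_real z (r : R) : complex.Re (z * real_complex R r) = complex.Re z * r.
Proof. by case: z => a b /=; rewrite mulr0 subr0. Qed.

Lemma Im_mulr_real z (r : R) : complex.Im (z * real_complex R r) = complex.Im z * r.
Proof. by case: z => a b /=; rewrite mulr0 add0r. Qed.

Lemma lcoordE w x :
  lcoord w x = ((Re_row w *m x) ord0 ord0 +i* (Im_row w *m x) ord0 ord0)%C.
Proof.
rewrite /lcoord; apply/eqP; rewrite eq_complex !mxE Re_sum Im_sum /=.
by apply/andP; split; apply/eqP; apply: eq_bigr => k _;
  rewrite !mxE ?Re_mulr_real ?Im_mulr_real.
Qed.

Lemma lcoordB w x y : lcoord w (x - y) = lcoord w x - lcoord w y.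
Proof. by rewrite /lcoord /cplx_mx map_mxB mulmxBr !mxE. Qed.

Lemma lcoordZ w (r : R) x : lcoord w (r *: x) = real_complex R r * lcoord w x.
Proof. by rewrite /lcoord /cplx_mx map_mxZ -scalemxAr !mxE. Qed.

Lemma lcoord_real (u x : 'cV[R]_n.+1) :
  lcoord (cplx_mx u) x = real_complex R ((u^T *m x) ord0 ord0).
Proof. by rewrite /lcoord /cplx_mx matrix.map_trmx -map_mxM mxE. Qed.

Lemma normc_lcoord_le w x :
  normc (lcoord w x) <= \sum_k normc (w k ord0) * `|x k ord0|.
Proof.
rewrite /lcoord mxE; apply: le_trans (normc_sum _ _) _.
by apply: ler_sum => k _; rewrite !mxE normcM normc_real.
Qed.

Section eigen.
Variables (A : 'M[R]_n.+1) (w : 'cV[R[i]]_n.+1) (lam : R[i]).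
Hypothesis wA : w^T *m cplx_mx A = lam *: w^T.

Lemma lcoord_eigen x : lcoord w (A *m x) = lam * lcoord w x.
Proof. by rewrite /lcoord /cplx_mx map_mxM mulmxA wA -scalemxAl mxE. Qed.

Lemma Re_row_eigen :
  Re_row w *m A = complex.Re lam *: Re_row w - complex.Im lam *: Im_row w.
Proof.
apply/rowP => j.
have /(congr1 (@complex.Re R)) := congr1 (fun M : 'rV[R[i]]_n.+1 => M ord0 j) wA.
rewrite !mxE Re_sum => E; rewrite -[RHS]/(_ - _).
transitivity (complex.Re (lam * w j ord0)); last by case: lam (w j ord0) => a b [].
rewrite -E; apply: eq_bigr => k _; by rewrite !mxE Re_mulr_real.
Qed.

Lemma Im_row_eigen :
  Im_row w *m A = complex.Im lam *: Re_row w + complex.Re lam *: Im_row w.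
Proof.
apply/rowP => j.
have /(congr1 (@complex.Im R)) := congr1 (fun M : 'rV[R[i]]_n.+1 => M ord0 j) wA.
rewrite !mxE Im_sum => E.
transitivity (complex.Im (lam * w j ord0)).
  by rewrite -E; apply: eq_bigr => k _; rewrite !mxE Im_mulr_real.
by case: lam (w j ord0) => a b [c d]; rewrite addrC.
Qed.

(** With mu + i nu the eigenvalue, the real and imaginary parts p, q of the
coordinate satisfy p' = mu p - nu q and q' = nu p + mu q. The rotation terms
cancel in (p^2 + q^2)' = 2 mu (p^2 + q^2), so (p^2 + q^2) e^(- 2 mu t) is
constant. *)
Lemma normc_lcoord_flow x t :
  normc (lcoord w (flow A t x)) = expR (complex.Re lam * t) * normc (lcoord w x).
Proof.
set mu := complex.Re lam; set nu := complex.Im lam.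
pose p (s : R) : R := (Re_row w *m flow A s x) ord0 ord0.
pose q (s : R) : R := (Im_row w *m flow A s x) ord0 ord0.
have dp (s : R) : is_derive s (1 : R) p (mu * p s - nu * q s).
  rewrite /p /q; apply: is_derive_eq; first exact: is_derive_flow.
  by rewrite Re_row_eigen mulmxBl -!scalemxAl !mxE.
have dq (s : R) : is_derive s (1 : R) q (nu * p s + mu * q s).
  rewrite /p /q; apply: is_derive_eq; first exact: is_derive_flow.
  by rewrite Im_row_eigen mulmxDl -!scalemxAl !mxE.
pose g (s : R) : R := expR ((- (2 * mu)) * s).
have dg (s : R) : is_derive s (1 : R) g (- (2 * mu) * g s).
  rewrite /g; apply: is_derive_eq; rewrite /GRing.scale /= mulr1 mulrC //.
pose f : R -> R := (p * p + q * q) * g.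
have fC : f t = f 0.
  apply: is_derive_0_is_cst => s.
  apply: (is_derive_eq (is_deriveM
    (is_deriveD (is_deriveM (dp s) (dp s)) (is_deriveM (dq s) (dq s))) (dg s))).
  rewrite /GRing.scale /=; rewrite !fctE; ring.
have E (s : R) : f s = normc (lcoord w (flow A s x)) ^+ 2 * g s.
  by rewrite lcoordE sqr_normc_ReIm !expr2.
have g0 : g 0 = 1 by rewrite /g mulr0 expR0.
have {E} := etrans (esym (E t)) (etrans fC (E 0)).
rewrite flow0 g0 mulr1.
have -> : g t = (expR (mu * t) ^+ 2)^-1.
  by rewrite /g -expRM_natl -expRN; congr expR; ring.
move: (normc_ge0 (lcoord w x)) (normc_ge0 (lcoord w (flow A t x))).
move: (normc (lcoord w x)) (normc (lcoord w (flow A t x))) => a b a0 b0.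
move=> /(canRL (mulfVK (expf_neq0 2 (lt0r_neq0 (expR_gt0 (mu * t)))))) ab.
apply/eqP; rewrite -(eqrXn2 (n := 2)) ?mulr_ge0 ?expR_ge0 //.
by rewrite ab exprMn mulrC.
Qed.

End eigen.
End left_coordinate.

(** * Dini derivatives along the flow *)

Lemma positive_lower_bound (R : realDomainType) (I : finType) (F : I -> R) :
  (forall i, 0 < F i) -> exists2 m, 0 < m & forall i, m <= F i.
Proof.
move=> F0; exists (\big[Num.min/1]_i F i) => [|i]; last exact: bigmin_le.
by elim/big_ind : _ => // a b a0 b0; rewrite lt_min a0.
Qed.

Lemma le_term_sum (R : numDomainType) (I : finType) (F : I -> R) i :
  (forall j, 0 <= F j) -> F i <= \sum_j F j.
Proof. by move=> F0; rewrite (bigD1 i) //= lerDl sumr_ge0. Qed.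

Lemma row_mul_gt0 (R : realType) n (a : 'rV[R]_n.+1) (x : 'cV[R]_n.+1) :
  (forall j, 0 < a ord0 j) -> nonneg_orthant R n x -> x != 0 ->
  0 < (a *m x) ord0 ord0.
Proof.
move=> a0 x0 xN0; have [k xk] : exists k, x k ord0 != 0.
  apply/existsP; apply: contraNT xN0; rewrite negb_exists => /forallP xz.
  by apply/eqP/colP => i; rewrite mxE; apply/eqP/negbNE.
rewrite mxE (bigD1 k) //= ltr_pwDl //.
  by rewrite mulr_gt0 // lt_def xk x0.
by apply: sumr_ge0 => j _; rewrite mulr_ge0 // ltW.
Qed.

Section orbital.
Variables (R : realType) (n : nat) (A : 'M[R]_n.+1).
Implicit Types (V : 'cV[R]_n.+1 -> R) (x v : 'cV[R]_n.+1) (a : 'rV[R]_n.+1).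

(** A uniform negative bound c is needed: negativity of each quotient alone would
only give an upper limit at most 0. *)
Lemma orbital_derivative_lt0 V x (c : R) : c < 0 ->
  (\forall h \near 0^'+, (V (flow A h x) - V x) / h <= c) ->
  (orbital_derivative A V x < 0)%E.
Proof.
move=> c0 Vc; apply: (@le_lt_trans _ _ c%:E); last by rewrite lte_fin.
apply: (@le_trans _ _ (ereal_sup ((fun h : R =>
  ((V (flow A h x) - V x) / h)%:E) @` [set h | (V (flow A h x) - V x) / h <= c]))).
  by apply: ereal_inf_lbound; exists [set h | (V (flow A h x) - V x) / h <= c].
by apply: ge_ereal_sup => _ [h hc <-]; rewrite lee_fin.
Qed.

Lemma continuous_row a : continuous (fun x => (a *m x) ord0 ord0).
Proof.
have -> : (fun x => (a *m x) ord0 ord0) =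
    (fun x => (a *m x *m (1%:M : 'cV[R]_1)) ord0 ord0).
  by apply/funext => x; rewrite mulmx1.
move=> x; apply: (@cvg_bilin R _ (nbhs x) _ _ _ id x); exact: cvg_id.
Qed.

Lemma row_lyapunov a (S : set 'cV[R]_n.+1) :
  (forall x, S x -> x != 0 -> 0 < (a *m x) ord0 ord0) ->
  (forall x, S x -> x != 0 -> (a *m A *m x) ord0 ord0 < 0) ->
  is_lyapunov_on A S (fun x => (a *m x) ord0 ord0).
Proof.
move=> V0 dV0; split => //; first exact: continuous_row.
  by rewrite mulmx0 mxE.
move=> x Sx xN0; have d0 := dV0 _ Sx xN0.
apply: (@orbital_derivative_lt0 _ _ ((a *m A *m x) ord0 ord0 / 2)); first lra.
have := @cvgr_le _ _ _ _ _ _ (flow_quotient A a x); apply; lra.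
Qed.

Section max_ratio.
Variable v : 'cV[R]_n.+1.
Hypothesis v0 : pos_orthant R n v.

Lemma ratio_le_max x k : x k ord0 / v k ord0 <= max_ratio v x.
Proof. exact: le_bigmax. Qed.

Lemma max_ratio_le x m :
  (forall k, x k ord0 / v k ord0 <= m) -> max_ratio v x <= m.
Proof. by move=> xm; apply: bigmax_le. Qed.

Lemma continuous_max_ratio : continuous (max_ratio v).
Proof.
move=> x; apply: (@cvgrPdist_le _ _ _ (nbhs x) (nbhs_filter x)
  (max_ratio v) (max_ratio v x)).2 => e e0.
have : \forall y \near x, forall k : 'I_n.+1,
    `|x k ord0 / v k ord0 - (y : 'cV[R]_n.+1) k ord0 / v k ord0| <= e.
  apply: (@filter_forall _ _ _ (nbhs x) (nbhs_filter x)) => k.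
  apply: (cvgrPdist_le _ _).1 => //.
  by apply: cvgMr_tmp; exact: coord_continuous.
apply: filterS => y xy; rewrite ler_distl; apply/andP; split.
  rewrite lerBlDr; apply: max_ratio_le => k.
  have := xy k; rewrite ler_distl => /andP[+ _]; rewrite lerBlDr => /le_trans; apply.
  by rewrite lerD2r ratio_le_max.
apply: max_ratio_le => k.
have := xy k; rewrite ler_distl => /andP[_ /le_trans]; apply.
by rewrite lerD2r ratio_le_max.
Qed.

(** If every ratio decreases at a rate greater than m / 2, every ratio at a small
time h is at most max_ratio v x - (m / 2) h, hence so is the largest of them. *)
Lemma max_ratio_orbital_lt0 x : (forall k, (A *m x) k ord0 < 0) ->
  (orbital_derivative A (max_ratio v) x < 0)%E.
Proof.
move=> Ax0.
have [k|m m0 mle] := @positive_lower_bound _ _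
    (fun k => - ((A *m x) k ord0 / v k ord0)).
  by rewrite oppr_gt0 pmulr_llt0 // invr_gt0.
apply: (@orbital_derivative_lt0 _ _ (- (m / 2))); first lra.
have H : \forall h \near 0^'+, forall k : 'I_n.+1,
    (flow A h x k ord0 / v k ord0 - x k ord0 / v k ord0) / h <= - (m / 2).
  apply: filter_forall => k.
  pose a : 'rV[R]_n.+1 := (v k ord0)^-1 *: delta_mx ord0 k.
  have aE (M : 'cV[R]_n.+1) : (a *m M) ord0 ord0 = M k ord0 / v k ord0.
    by rewrite -scalemxAl -rowE !mxE mulrC.
  have cv := flow_quotient A a x; rewrite -mulmxA !aE in cv.
  have mk : (A *m x) k ord0 / v k ord0 < - (m / 2) by have := mle k; lra.
  have H : \forall h \near 0^'+, ((a *m flow A h x) ord0 ord0 -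
      x k ord0 / v k ord0) / h <= - (m / 2) := cvgr_le _ cv _ mk.
  by near=> h; rewrite -(aE (flow A h x)); near: h; exact: H.
near=> h; have h0 : 0 < h by near: h; exact: nbhs_right_gt.
rewrite ler_pdivrMr // lerBlDr; apply: max_ratio_le => k.
have : (flow A h x k ord0 / v k ord0 - x k ord0 / v k ord0) / h <= - (m / 2).
  by move: k; near: h; exact: H.
rewrite ler_pdivrMr // lerBlDr => /le_trans; apply.
by rewrite lerD2l ratio_le_max.
Unshelve. all: by end_near. Qed.

End max_ratio.
End orbital.

(** * Stability and the spectrum *)

Section spectral.
Variables (R : realType) (n : nat) (A : 'M[R]_n.+1).
Variables (lambda : 'I_n.+1 -> R[i]) (w : 'I_n.+1 -> 'cV[R[i]]_n.+1).
Hypothesis wA : forall i, (w i)^T *m cplx_mx A = lambda i *: (w i)^T.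
Hypothesis hfree : row_free (\matrix_(i < n.+1) (w i)^T).
Implicit Types (x y : 'cV[R]_n.+1).

(** The matrix W with rows (w i)^T is invertible, so x = W^-1 (W x); C sums the
moduli of all the entries of W^-1. *)
Lemma entry_le_lcoord : exists2 C : R, 0 <= C &
  forall x k, `|x k ord0| <= C * \sum_i normc (lcoord (w i) x).
Proof.
pose W := \matrix_(i < n.+1) (w i)^T.
have Wu : W \in unitmx by rewrite -row_free_unit.
exists (\sum_k \sum_i normc (invmx W k i)) => [|x k].
  by do 2!(apply: sumr_ge0 => ? _); exact: normc_ge0.
have -> : `|x k ord0| = normc ((invmx W *m (W *m cplx_mx x)) k ord0).
  by rewrite mulKmx // mxE normc_real.
rewrite mxE (le_trans (normc_sum _ _)) // mulr_sumr; apply: ler_sum => i _.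
have -> : (W *m cplx_mx x) i ord0 = lcoord (w i) x.
  transitivity ((row i (W *m cplx_mx x)) ord0 ord0); first by rewrite !mxE.
  by rewrite row_mul rowK.
rewrite normcM ler_wpM2r ?normc_ge0 //.
apply: (le_trans (le_term_sum (F := fun j => normc (invmx W k j)) i _)).
  by move=> j; exact: normc_ge0.
apply: (le_term_sum (F := fun k => \sum_j normc (invmx W k j))).
by move=> j; apply: sumr_ge0 => ? _; exact: normc_ge0.
Qed.

Lemma flow_entry_le : exists2 C : R, 0 <= C & forall x t k,
  `|flow A t x k ord0| <=
  C * \sum_i expR (complex.Re (lambda i) * t) * normc (lcoord (w i) x).
Proof.
have [C C0 xC] := entry_le_lcoord; exists C => // x t k.
apply: le_trans (xC _ _) _; rewrite ler_wpM2l //; apply: ler_sum => i _.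
by rewrite (normc_lcoord_flow (wA i)).
Qed.

Lemma expR_decay (mu : R) : mu < 0 -> expR (mu * t) @[t --> +oo] --> 0.
Proof.
move=> mu0; have -> : (fun t => expR (mu * t)) = (fun t => expR (- (- mu * t))).
  by apply/funext => t; rewrite mulNr opprK.
apply: (@cvg_comp _ _ _ (fun t => - mu * t) (fun u => expR (- u)) _ +oo).
  by apply: gt0_cvgMry; [rewrite oppr_gt0|exact: cvg_id].
exact: cvgr_expR.
Qed.

(** Since all exponential factors are at most 1 for t >= 0, the flow is bounded by
a multiple of the initial norm, and each factor tends to 0. *)
Lemma negative_spectrum_stable :
  (forall i, complex.Re (lambda i) < 0) -> asymptotically_stable A.
Proof.
move=> neg; have [C C0 flowC] := flow_entry_le.
pose D := \sum_i \sum_k normc (w i k ord0).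
have D0 : 0 <= D by do 2!(apply: sumr_ge0 => ? _); exact: normc_ge0.
split.
  (* D bounds the sum of the moduli of the coordinates by D times the norm of x,
     so C * D bounds the flow; adding 1 makes the denominator positive. *)
  move=> e e0; exists (e / (C * D + 1)).
    by rewrite divr_gt0 // ltr_wpDl // mulr_ge0.
  move=> x; rewrite ltr_pdivlMr ?ltr_wpDl ?mulr_ge0 // => xe t t0.
  apply: le_lt_trans xe; rewrite mulrDr mulr1 -[leLHS]addr0 lerD ?normr_ge0 //.
  apply: ler_mx_normP => [|k j]; first by rewrite !mulr_ge0.
  rewrite ord1 (le_trans (flowC _ _ _)) // mulrCA ler_wpM2l //.
  rewrite mulr_sumr; apply: ler_sum => i _.
  apply: (@le_trans _ _ (1 * normc (lcoord (w i) x))).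
    rewrite ler_wpM2r ?normc_ge0 // -expR0 ler_expR.
    by rewrite mulr_le0_ge0 // ltW.
  rewrite mul1r (le_trans (normc_lcoord_le _ _)) // mulr_sumr.
  apply: ler_sum => l _; rewrite mulrC ler_wpM2r ?normc_ge0 //.
  exact: (ler_mx_entry x l ord0).
exists 1 => // x _; apply/cvg_mxP => k j; rewrite ord1 mxE.
have G0 : C * (\sum_i expR (complex.Re (lambda i) * t) * normc (lcoord (w i) x))
    @[t --> +oo] --> C * \sum_(i < n.+1) 0.
  apply: cvgMl_tmp; apply: (cvg_big (op := +%R)) => [|i _].
    exact: add_continuous.
  rewrite -[X in _ --> X](mul0r (normc (lcoord (w i) x))).
  by apply: cvgMr_tmp; exact: expR_decay.
rewrite big1 // mulr0 in G0.
apply/cvgr0Pnorm_le => e e0.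
near=> t; apply: le_trans (flowC _ _ _) _.
by near: t; exact: (cvgr_le _ G0 _ e0).
Unshelve. all: by end_near. Qed.

(** If mu >= 0, the coordinate along u of a trajectory starting at a multiple of v
keeps modulus at least its nonzero initial value, so it cannot tend to 0. *)
Lemma stable_real_eigenvalue_lt0 (mu : R) (u v : 'cV[R]_n.+1) :
  u^T *m A = mu *: u^T -> (u^T *m v) ord0 ord0 != 0 ->
  locally_attractive A -> mu < 0.
Proof.
move=> uA uv [r r0 attr]; rewrite ltNge; apply/negP => mu0.
(* The multiple c *: v lies in the ball of attraction of radius r. *)
pose c := r / (`|v| + 1).
have v1 : 0 < `|v| + 1 by rewrite ltr_wpDl.
have c0 : 0 < c by rewrite divr_gt0.
have cvr : `|c *: v| < r.
  rewrite normrZ gtr0_norm // /c mulrAC ltr_pdivrMr // ltr_pM2l //.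
  by rewrite ltrDl.
have to0 : (u^T *m flow A t (c *: v)) ord0 ord0 @[t --> +oo] --> 0.
  have -> : (fun t => (u^T *m flow A t (c *: v)) ord0 ord0) =
    (fun t => (u^T *m flow A t (c *: v) *m (1%:M : 'cV[R]_1)) ord0 ord0).
    by apply/funext => t; rewrite mulmx1.
  have -> : 0 = (u^T *m (0 : 'cV[R]_n.+1) *m (1%:M : 'cV[R]_1)) ord0 ord0.
    by rewrite mulmx0 mul0mx mxE.
  by apply: cvg_bilin; exact: attr.
have uAC : (cplx_mx u)^T *m cplx_mx A = real_complex R mu *: (cplx_mx u)^T.
  by rewrite /cplx_mx matrix.map_trmx -map_mxM uA map_mxZ.
pose d := `|(u^T *m (c *: v)) ord0 ord0|.
have d0 : 0 < d by rewrite normr_gt0 -scalemxAr mxE mulf_neq0 // gt_eqF.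
have : \forall t \near +oo, `|(u^T *m flow A t (c *: v)) ord0 ord0| < d.
  exact: ((cvgr0Pnorm_lt _).1 to0).
move=> near_small; near (pinfty_nbhs R) => t.
have : `|(u^T *m flow A t (c *: v)) ord0 ord0| < d by near: t; exact: near_small.
rewrite ltNge => /negP; apply.
rewrite -normc_real -lcoord_real (normc_lcoord_flow uAC) lcoord_real normc_real.
have t0 : 0 <= t by near: t; apply: nbhs_pinfty_ge; rewrite num_real.
by rewrite ler_peMl ?normr_ge0 // -expR0 ler_expR mulr_ge0.
Unshelve. all: by end_near. Qed.

(** * The cones around the dominant eigenvector *)

Section cone.
Variables (w1 v1 : 'cV[R]_n.+1) (lambda1 : R).
Hypothesis w0 : w ord0 = cplx_mx w1.
Hypothesis dom : forall j, j != ord0 -> complex.Re (lambda j) < lambda1.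
Hypothesis v1A : A *m v1 = lambda1 *: v1.
Hypothesis v1pos : pos_orthant R n v1.
Hypothesis w1pos : pos_orthant R n w1.

Let z1 x := (w1^T *m x) ord0 ord0.

Lemma coneP alpha y : (forall i, 0 < alpha i) -> cone w1 w alpha y <->
  0 <= z1 y /\
  \sum_(i < n) alpha i * normc (lcoord (w (lift ord0 i)) y) ^+ 2 <= z1 y ^+ 2.
Proof.
move=> a0; rewrite /cone /= -/(z1 y).
set S := (X in Num.sqrt X).
have S0 : 0 <= S by apply: sumr_ge0 => i _; rewrite mulr_ge0 ?sqr_ge0 // ltW.
split=> [Sz|[zz Sz]].
  have zz : 0 <= z1 y := le_trans (sqrtr_ge0 _) Sz.
  by split=> //; rewrite -[leLHS](sqr_sqrtr S0) lerXn2r ?nnegrE ?sqrtr_ge0.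
by rewrite -(ger0_norm zz) -sqrtr_sqr ler_wsqrtr.
Qed.

(** On the cone w1^T y dominates all the other coordinates: if it vanishes, all
coordinates vanish, and so does y. *)
Lemma cone_z1_gt0 alpha y : (forall i, 0 < alpha i) ->
  cone w1 w alpha y -> y != 0 -> 0 < z1 y.
Proof.
move=> a0 /(coneP _ a0)[zz Sz] yN0; rewrite lt_def zz andbT.
apply: contra yN0 => /eqP yz; rewrite yz expr0n /= in Sz.
have wi0 i : normc (lcoord (w i) y) = 0.
  case: (unliftP ord0 i) => [j|] ->; last first.
    by rewrite w0 lcoord_real -/(z1 y) yz normc_real normr0.
  have := le_trans (le_term_sum (F := fun i =>
    alpha i * normc (lcoord (w (lift ord0 i)) y) ^+ 2) j _) Sz.
  rewrite pmulr_rle0 // => H; apply/eqP; rewrite -sqrf_eq0 eq_le sqr_ge0 andbT.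
  by apply: H => i'; rewrite mulr_ge0 ?sqr_ge0 // ltW.
have [C C0 yC] := entry_le_lcoord; apply/eqP/colP => k; rewrite mxE; apply/eqP.
by rewrite -normr_le0 (le_trans (yC _ _)) // big1 ?mulr0.
Qed.

(** On the orthant w1^T y is a sum of nonnegative terms w1_k y_k, each of which
controls |y_k|; so each |(w i)^T y| is at most D i times w1^T y, and the weights
only have to absorb the squares of the constants D i. *)
Lemma nonneg_orthant_sub_cone : exists alpha : 'I_n -> R,
  (forall i, 0 < alpha i) /\ nonneg_orthant R n `<=` cone w1 w alpha.
Proof.
pose D i := \sum_k normc (w (lift ord0 i) k ord0) / w1 k ord0.
have S0 : 0 <= \sum_i D i ^+ 2 by apply: sumr_ge0 => i _; exact: sqr_ge0.
pose a := (1 + \sum_i D i ^+ 2)^-1.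
have a0 : 0 < a by rewrite invr_gt0 ltr_pwDl.
exists (fun=> a); split=> // y y0; apply/coneP => //.
have zE : z1 y = \sum_k w1 k ord0 * y k ord0.
  by rewrite /z1 mxE; apply: eq_bigr => k _; rewrite mxE.
have wy k : 0 <= w1 k ord0 * y k ord0 by rewrite mulr_ge0 // ltW.
have zz : 0 <= z1 y by rewrite zE sumr_ge0.
split=> //; apply: (@le_trans _ _ (\sum_i a * (D i ^+ 2 * z1 y ^+ 2))).
  apply: ler_sum => i _; rewrite ler_wpM2l ?(ltW a0) // -exprMn.
  have Dz : normc (lcoord (w (lift ord0 i)) y) <= D i * z1 y.
    apply: le_trans (normc_lcoord_le _ _) _; rewrite mulr_suml.
    apply: ler_sum => k _; rewrite -mulrA ler_wpM2l ?normc_ge0 //.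
    rewrite mulrC ler_pdivlMr // ger0_norm // mulrC zE.
    exact: (le_term_sum (F := fun k => w1 k ord0 * y k ord0)).
  by rewrite lerXn2r ?nnegrE ?normc_ge0 // (le_trans _ Dz) ?normc_ge0.
rewrite -mulr_sumr -mulr_suml mulrA ler_piMl ?sqr_ge0 //.
by rewrite /a mulrC ler_pdivrMr ?ltr_pwDl // mul1r lerDr.
Qed.

(** Biorthogonality: the eigenvalue of w j differs from that of v1. *)
Lemma lcoord_v1 j : j != ord0 -> lcoord (w j) v1 = 0.
Proof.
move=> j0; have := lcoord_eigen (wA j) v1; rewrite v1A lcoordZ.
move=> /eqP; rewrite -subr_eq0 -mulrBl mulf_eq0 => /orP[|/eqP //].
rewrite subr_eq0 => /eqP E; have := dom j0.
by rewrite -E /= ltxx.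
Qed.

Lemma z1_v1_gt0 : 0 < z1 v1.
Proof.
apply: row_mul_gt0 => [j||]; first by rewrite mxE.
  by move=> k; rewrite ltW.
by apply/eqP => /colP/(_ ord0); rewrite mxE => /eqP; rewrite gt_eqF.
Qed.

(** Subtracting from y its component along v1 kills the coordinate along w1 and
leaves the others unchanged, and with weights s^2 these are at most z1 y / s.
Applying A multiplies them by the eigenvalues, which the factor 1 + L absorbs,
so that a single K serves both for y and for A y. *)
Lemma narrow_cone_near_v1 : exists2 K : R, 0 <= K &
  forall s y, 0 < s -> cone w1 w (fun=> s ^+ 2) y -> forall k,
  `|(y - (z1 y / z1 v1) *: v1) k ord0| <= K * (z1 y / s) /\
  `|(A *m (y - (z1 y / z1 v1) *: v1)) k ord0| <= K * (z1 y / s).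
Proof.
have [C C0 xC] := entry_le_lcoord.
pose L := \sum_i normc (lambda i).
have L0 : 0 <= L by apply: sumr_ge0 => i _; exact: normc_ge0.
exists (C * (\sum_(i < n.+1) (1 + L))) => [|s y s0 cy k].
  by rewrite mulr_ge0 // sumr_ge0 // => i _; rewrite addr_ge0.
have [zz Sz] := (coneP y (fun=> exprn_gt0 2 s0)).1 cy.
set u := y - _.
have zs0 : 0 <= z1 y / s by rewrite divr_ge0 // ltW.
have ui i : normc (lcoord (w i) u) <= z1 y / s.
  rewrite /u lcoordB lcoordZ.
  case: (unliftP ord0 i) => [j|] ->; last first.
    rewrite w0 !lcoord_real -/(z1 y) -/(z1 v1) -rmorphM -rmorphB.
    by rewrite mulfVK ?gt_eqF ?z1_v1_gt0 // subrr normc_real normr0.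
  rewrite lcoord_v1 // mulr0 subr0 ler_pdivlMr // mulrC.
  rewrite -(@ler_pXn2r _ 2) ?nnegrE ?mulr_ge0 ?normc_ge0 ?(ltW s0) //.
  rewrite exprMn; apply: le_trans Sz.
  apply: (le_term_sum (F := fun i =>
    s ^+ 2 * normc (lcoord (w (lift ord0 i)) y) ^+ 2)) => i'.
  by rewrite mulr_ge0 ?sqr_ge0.
split; apply: le_trans (xC _ _) _; rewrite -mulrA ler_wpM2l // mulr_suml.
  apply: ler_sum => i _; apply: le_trans (ui i) _.
  by rewrite ler_peMl // lerDl.
apply: ler_sum => i _; rewrite (lcoord_eigen (wA i)) normcM.
apply: ler_pM; rewrite ?normc_ge0 //.
apply: le_trans (le_term_sum (F := fun i => normc (lambda i)) i _) _.
  by move=> j; exact: normc_ge0.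
by rewrite lerDr.
Qed.

(** Both v1 and - lambda1 v1 are strictly positive, so errors of relative size
K / s do not change the signs of y and A y once s is large. *)
Lemma narrow_cone : lambda1 < 0 -> exists2 s : R, 0 < s &
  forall y, cone w1 w (fun=> s ^+ 2) y -> y != 0 ->
  forall k, 0 < y k ord0 /\ (A *m y) k ord0 < 0.
Proof.
move=> l0; have [K K0 yK] := narrow_cone_near_v1; have g0 := z1_v1_gt0.
have [k|m m0 mle] := positive_lower_bound (F := fun k => v1 k ord0 / z1 v1).
  by rewrite divr_gt0.
have [k|m' m'0 m'le] :=
    positive_lower_bound (F := fun k => - lambda1 * (v1 k ord0 / z1 v1)).
  by rewrite mulr_gt0 ?oppr_gt0 // divr_gt0.
(* This makes K / s smaller than m and m', lower bounds for the entries of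
   v1 / z1 v1 and of - lambda1 v1 / z1 v1. *)
pose s := K / m + K / m' + 1.
have Km0 : 0 <= K / m by rewrite divr_ge0 // ltW.
have Km'0 : 0 <= K / m' by rewrite divr_ge0 // ltW.
have s0 : 0 < s by rewrite ltr_wpDl // addr_ge0.
have Ks : K / s < m.
  by rewrite ltr_pdivrMr // mulrC -ltr_pdivrMr // /s; lra.
have Ks' : K / s < m'.
  by rewrite ltr_pdivrMr // mulrC -ltr_pdivrMr // /s; lra.
exists s => // y cy yN0 k.
have z0 := cone_z1_gt0 (fun=> exprn_gt0 2 s0) cy yN0.
have [] := yK s y s0 cy k.
set c := z1 y / z1 v1; rewrite mulmxBr -scalemxAr v1A !mxE.
have -> : K * (z1 y / s) = z1 y * (K / s) by rewrite mulrCA.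
have cv : c * v1 k ord0 = z1 y * (v1 k ord0 / z1 v1) by rewrite /c mulrAC mulrA.
have clv : c * (lambda1 * v1 k ord0) = - (z1 y * (- lambda1 * (v1 k ord0 / z1 v1))).
  by rewrite mulrCA cv; ring.
rewrite cv clv !ler_norml => /andP[H1 _] /andP[_ H2]; split.
  have : z1 y * (K / s) < z1 y * (v1 k ord0 / z1 v1).
    by rewrite ltr_pM2l // (lt_le_trans Ks).
  by lra.
have : z1 y * (K / s) < z1 y * (- lambda1 * (v1 k ord0 / z1 v1)).
  by rewrite ltr_pM2l // (lt_le_trans Ks').
lra.
Qed.

End cone.
End spectral.

(** * The Lyapunov functions *)

Theorem theorem3 (R : realType) (n : nat) (A : 'M[R]_n.+1)
  (lambda : 'I_n.+1 -> R[i]) (lambda1 : R)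
  (v1 w1 : 'cV[R]_n.+1) (w : 'I_n.+1 -> 'cV[R[i]]_n.+1)
  (hdiag : diagonalizable (cplx_mx A))
  (heig : char_poly (cplx_mx A) = \prod_(i < n.+1) ('X - (lambda i)%:P))
  (hsep : strongly_eventually_positive A)
  (hlambda1 : lambda ord0 = real_complex R lambda1)
  (hsimple : mup (lambda ord0) (char_poly (cplx_mx A)) = 1%N)
  (hdom : forall j : 'I_n.+1, j != ord0 -> complex.Re (lambda j) < lambda1)
  (hv1 : A *m v1 = lambda1 *: v1) (hv1pos : pos_orthant R n v1)
  (hw1 : w1^T *m A = lambda1 *: w1^T) (hw1pos : pos_orthant R n w1)
  (hw0 : w ord0 = cplx_mx w1)
  (hw : forall i : 'I_n.+1,
     w i != 0 /\ (w i)^T *m cplx_mx A = lambda i *: (w i)^T)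
  (hfree : row_free (\matrix_(i < n.+1) (w i)^T)) :
  [/\ (* (i) *)
      asymptotically_stable A <->
        (exists xi : 'cV[R]_n.+1, pos_orthant R n xi /\
           forall j : 'I_n.+1, (xi^T *m A) ord0 j < 0),
      (* (ii) *)
      (forall xi : 'cV[R]_n.+1, pos_orthant R n xi ->
         (forall j : 'I_n.+1, (xi^T *m A) ord0 j < 0) ->
         forall alpha : 'I_n -> R, (forall i, 0 < alpha i) ->
         cone w1 w alpha `<=` nonneg_orthant R n ->
         is_lyapunov_on A (cone w1 w alpha)
           (fun x => (xi^T *m x) ord0 ord0))
      /\
      (asymptotically_stable A ->
         (forall alpha : 'I_n -> R, (forall i, 0 < alpha i) ->
            is_lyapunov_on A (cone w1 w alpha)
              (fun x => (x^T *m w1) ord0 ord0))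
         /\
         (exists alpha : 'I_n -> R,
            [/\ (forall i, 0 < alpha i),
                nonneg_orthant R n `<=` cone w1 w alpha &
                is_lyapunov_on A (cone w1 w alpha)
                  (fun x => (x^T *m w1) ord0 ord0)])) &
      (* (iii) *)
      (asymptotically_stable A ->
         exists alpha : 'I_n -> R,
           [/\ (forall i, 0 < alpha i),
               cone w1 w alpha `<=` nonneg_orthant R n &
               is_lyapunov_on A (cone w1 w alpha) (max_ratio v1)])].
Proof.
have wA i : (w i)^T *m cplx_mx A = lambda i *: (w i)^T := (hw i).2.
have w1v1 : (w1^T *m v1) ord0 ord0 != 0 by rewrite gt_eqF // z1_v1_gt0.
have stable_lt0 : asymptotically_stable A -> lambda1 < 0.
  by case=> _; exact: (stable_real_eigenvalue_lt0 hw1 w1v1).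
have lt0_stable : lambda1 < 0 -> asymptotically_stable A.
  move=> l0; apply: (negative_spectrum_stable wA hfree) => i.
  have [->|i0] := eqVneq i ord0; first by rewrite hlambda1.
  exact: lt_trans (hdom _ i0) l0.
have w1_lyapunov alpha : lambda1 < 0 -> (forall i, 0 < alpha i) ->
    is_lyapunov_on A (cone w1 w alpha) (fun x => (x^T *m w1) ord0 ord0).
  move=> l0 a0; have -> : (fun x : 'cV[R]_n.+1 => (x^T *m w1) ord0 ord0) =
      (fun x => (w1^T *m x) ord0 ord0).
    apply/funext => x; rewrite !mxE; apply: eq_bigr => k _.
    by rewrite !mxE mulrC.
  have z1_gt0 := cone_z1_gt0 hfree hw0 a0.
  apply: row_lyapunov => // x Kx xN0.
  by rewrite hw1 -scalemxAl mxE pmulr_llt0 // z1_gt0.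
split.
- split=> [/stable_lt0 l0|[xi [xi0 xiA]]].
    exists w1; split=> // j; rewrite hw1 !mxE pmulr_llt0 //; exact: hw1pos.
  apply: lt0_stable.
  have xiv1 : 0 < (xi^T *m v1) ord0 ord0.
    by apply: (z1_v1_gt0 hv1pos xi0).
  have : 0 < (- (xi^T *m A) *m v1) ord0 ord0.
    apply: row_mul_gt0 => [j|k|]; first by rewrite mxE oppr_gt0.
      by rewrite ltW.
    by apply/eqP => /colP/(_ ord0); rewrite mxE => /eqP; rewrite gt_eqF.
  by rewrite mulNmx -mulmxA hv1 -scalemxAr 2!mxE oppr_gt0 pmulr_llt0.
- split=> [xi xi0 xiA alpha a0 Kpos|/stable_lt0 l0].
    apply: row_lyapunov => x Kx xN0.
      by apply: row_mul_gt0 => //; [move=> j; rewrite mxE|exact: Kpos].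
    have -> : (xi^T *m A *m x) ord0 ord0 = - (- (xi^T *m A) *m x) ord0 ord0.
      by rewrite mulNmx [in RHS]mxE opprK.
    rewrite oppr_lt0.
    by apply: row_mul_gt0 => //; [move=> j; rewrite mxE oppr_gt0|exact: Kpos].
  split=> [alpha a0|]; first exact: w1_lyapunov.
  have [alpha [a0 sub]] := nonneg_orthant_sub_cone w hw1pos.
  by exists alpha; split=> //; exact: w1_lyapunov.
- move=> /stable_lt0 l0.
  have [s s0 sK] := narrow_cone wA hfree hw0 hdom hv1 hv1pos hw1pos l0.
  have s20 : 0 < s ^+ 2 by rewrite exprn_gt0.
  exists (fun=> s ^+ 2); split=> //.
    move=> y Ky k; have [->|yN0] := eqVneq y 0; first by rewrite mxE.
    by apply/ltW; have [] := sK y Ky yN0 k.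
  split.
  + exact: continuous_max_ratio.
  + apply/le_anti/andP; split.
      by apply: max_ratio_le => k; rewrite mxE mul0r.
    by apply: le_trans (ratio_le_max v1 0 ord0); rewrite mxE mul0r.
  + move=> y Ky yN0; apply: lt_le_trans (ratio_le_max v1 y ord0).
    by rewrite divr_gt0 //; have [] := sK y Ky yN0 ord0.
  + move=> y Ky yN0; apply: max_ratio_orbital_lt0 => // k.
    by have [] := sK y Ky yN0 k.
Qed.
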